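(* Let $N=n+d$. The complex $T'_{d,n}$ (equivalently $T_{d,n}$) is shellable; more precisely, the restriction to the facets of $T'_{d,n}$ of the shelling order on trivalent trees in $\mathcal T_N$ defined below is a shelling order of $T'_{d,n}$.
   Context: Labels $1,\dots,n\in[N]$ are marked and $n+1,\dots,n+d$ unmarked. A split $A|B$ of $[N]$ (partition into two nonempty parts) is bicolored if both parts have at least two elements and each part contains a marked and an unmarked label. Splits $A|A'$, $B|B'$ are compatible if one of $A\cap B,A\cap B',A'\cap B,A'\cap B'$ is empty. $T'_{d,n}$ (the space of $n$ tropically collinear points in $\mathbb{TP}^{d-1}=\mathbb R^d/\mathbb R(1,\dots,1)$ modulo simultaneous translation) is given the simplicial structure of the simplicial complex whose vertices are bicolored splits and whose faces are sets of pairwise compatible bicolored splits; its facets are the trivalent trees with leaf set $[N]$ all of whose internal edges induce bicolored splits (a tree is identified with the set of splits induced by its internal edges). Order on subsets of $[N]$: $A<B$ iff $\max\big((A\setminus B)\cup(B\setminus A)\big)\in B$. Order on trivalent trees: root a trivalent tree at leaf $1$; then each internal vertex $V$ has two child subtrees. For two rooted binary trees $T,T'$ with the same leaf set $L$ below the root vertex, let $M_0|M_1$ and $M_0'|M_1'$ be the partitions of $L$ into the leaf sets of the two children, labelled so that $\max L\in M_1$ and $\max L\in M_1'$, and let $T_0,T_1$ (resp. $T_0',T_1'$) be the corresponding subtrees. Then $T'<T$ iff $M_1'<M_1$, or $M_1'=M_1$ and $T_1'<T_1$, or $M_1'=M_1$, $T_1'=T_1$ and $T_0'<T_0$ (recursively;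 trees with a single leaf are equal). This applies with $L=[N]\setminus\{1\}$ to trivalent trees on $[N]$. A pure simplicial complex is shellable if its facets admit an order (a shelling) such that for any facets $C'<C$ there exist a facet $C''<C$ and a vertex $x\in C$ with $x\notin C'$ and $C\setminus\{x\}\subset C''$. *)

(* Defs.v *)
From mathcomp Require Import all_boot.

Set Implicit Arguments.
Unset Strict Implicit.
Unset Printing Implicit Defensive.

Section SimplicialComplex.

Variable V : finType.

Record simplicial_complex := SimplicialComplex {
  faces :> {set {set V}};
  faces_sub : forall F G : {set V}, F \in faces -> G \subset F -> G \in faces
}.

Variable K : simplicial_complex.

Definition facets : {set {set V}} :=
  [set F : {set V} | maxset (mem (faces K)) F].

Definition pure : Prop :=
  forall F G : {set V}, F \in facets -> G \in facets -> #|F| = #|G|.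

Definition strict_total_order_on_facets (lt : {set V} -> {set V} -> Prop) : Prop :=
  [/\ forall F, F \in facets -> ~ lt F F,
      forall F G H, F \in facets -> G \in facets -> H \in facets ->
        lt F G -> lt G H -> lt F H
    & forall F G, F \in facets -> G \in facets -> F <> G -> lt F G \/ lt G F].

Definition shelling_order (lt : {set V} -> {set V} -> Prop) : Prop :=
  [/\ pure,
      strict_total_order_on_facets lt
    & forall C' C, C' \in facets -> C \in facets -> lt C' C ->
        exists C'' x, [/\ C'' \in facets, lt C'' C, x \in C, x \notin C'
                        & C :\ x \subset C'']].

Definition shellable : Prop := exists lt, shelling_order lt.

End SimplicialComplex.

(* The label k of [N] = {1, ..., N} is the ordinal of value k - 1 in 'I_N; in
   particular the leaf 1 is the ordinal of value 0. *)

Section Splits.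

Variable N : nat.

(* The unordered split A|B is the two-element set of blocks [set A; B]. *)
Definition is_split (S : {set {set 'I_N}}) : bool :=
  partition S [set: 'I_N] && (#|S| == 2).

Definition compatible (S S' : {set {set 'I_N}}) : bool :=
  [exists A in S, exists B in S', A :&: B == set0].

End Splits.

Section BicoloredComplex.

Variables d n : nat.

Definition marked (i : 'I_(n + d)) : bool := i < n.

Definition bicolored (S : {set {set 'I_(n + d)}}) : bool :=
  is_split S &&
  [forall A in S, [&& 2 <= #|A|, [exists i in A, marked i]
                    & [exists i in A, ~~ marked i]]].

Definition bicolored_faces : {set {set {set {set 'I_(n + d)}}}} :=
  [set F : {set {set {set 'I_(n + d)}}} |
     [forall S in F, bicolored S] &&
     [forall S in F, forall S' in F, compatible S S']].

Lemma bicolored_faces_sub (F G : {set {set {set 'I_(n + d)}}}) :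
  F \in bicolored_faces -> G \subset F -> G \in bicolored_faces.
Proof.
rewrite !inE => /andP[/forall_inP bF /forall_inP cF] /subsetP sGF.
apply/andP; split; first by apply/forall_inP => S /sGF /bF.
apply/forall_inP => S /sGF SF; apply/forall_inP => S' /sGF S'F.
by have /forall_inP := cF S SF; apply.
Qed.

Definition Tprime : simplicial_complex {set {set 'I_(n + d)}} :=
  SimplicialComplex bicolored_faces_sub.

End BicoloredComplex.

Section Trees.

Variable N : nat.

Definition subset_lt (A B : {set 'I_N}) : bool :=
  let D := (A :\: B) :|: (B :\: A) in
  [exists x in D, [forall y in D, y <= x] && (x \in B)].

Inductive btree : Type :=
  | Leaf of 'I_N
  | Node of btree & btree.

Fixpoint leaves (T : btree) : seq 'I_N :=
  match T with
  | Leaf i => [:: i]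
  | Node T0 T1 => leaves T0 ++ leaves T1
  end.

Definition leaf_set (T : btree) : {set 'I_N} := [set i in leaves T].

Fixpoint max_in_second (T : btree) : bool :=
  match T with
  | Leaf _ => true
  | Node T0 T1 =>
      [&& max_in_second T0, max_in_second T1
        & [exists x in leaf_set T1, [forall y in leaf_set (Node T0 T1), y <= x]]]
  end.

(* A trivalent tree with leaf set [N], rooted at the leaf 1: the tree T on the
   leaves 2, ..., N with the leaf 1 attached to its root vertex. The two children
   of a vertex are unordered in the mathematical object; listing the child that
   contains the largest leaf below the vertex as the second one selects exactly
   one representative in btree and makes Node T0 T1 match the labelling T_0, T_1
   used by the order on trees. *)
Definition trivalent_tree (T : btree) : bool :=
  [&& uniq (leaves T), leaf_set T == [set i : 'I_N | i != 0 :> nat]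
    & max_in_second T].

Fixpoint tree_lt (T' T : btree) : Prop :=
  match T', T with
  | Node T0' T1', Node T0 T1 =>
      [\/ subset_lt (leaf_set T1') (leaf_set T1),
          leaf_set T1' = leaf_set T1 /\ tree_lt T1' T1
        | [/\ leaf_set T1' = leaf_set T1, T1' = T1 & tree_lt T0' T0]]
  | _, _ => False
  end.

Fixpoint internal_clusters (T : btree) : {set {set 'I_N}} :=
  match T with
  | Leaf _ => set0
  | Node T0 T1 => leaf_set T |: (internal_clusters T0 :|: internal_clusters T1)
  end.

(* The internal edges are those joining an internal vertex other than the root
   vertex to its parent; the edge from the root vertex to the leaf 1 is not
   internal. *)
Definition tree_splits (T : btree) : {set {set {set 'I_N}}} :=
  match T with
  | Leaf _ => set0
  | Node T0 T1 =>
      [set [set A; ~: A] | A in internal_clusters T0 :|: internal_clusters T1]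
  end.

(* The order on trivalent trees, each tree being identified with the set of
   splits induced by its internal edges. *)
Definition tree_order (F' F : {set {set {set 'I_N}}}) : Prop :=
  exists T' T : btree,
    [/\ trivalent_tree T', trivalent_tree T, tree_splits T' = F',
        tree_splits T = F & tree_lt T' T].

End Trees.

(* Main.v *)
Require Import Defs.
From mathcomp Require Import all_boot.

Set Implicit Arguments.
Unset Strict Implicit.
Unset Printing Implicit Defensive.

(* For a vertex with leaves below it split as [C | A + B], where B contains the
   largest of them, the flip to [A + C | B] lowers the tree.  It keeps all splits
   bicolored unless A and C are leaves of the same colour (B and the part above the
   vertex are never both leaves of the same colour, as the leaf 1 is marked and the
   leaf N is not); in that case exchanging A and C is admissible, and it lowers the
   tree exactly when C < A.  Call the edge above A + B blocked if A < C are leaves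
   of the same colour.  If a bicolored tree T' contains every non-blocked edge of T
   leading to a child with the largest leaf, then T <= T': at the root, the unblocked
   edges force the second child of T' to contain that of T, and a chain of blocked
   edges carries a decreasing sequence of equally coloured leaves, of which T' can
   only split off a single one. *)

Section SubsetOrder.

Variable N : nat.
Implicit Types A B C : {set 'I_N}.

Lemma set_max_exists A : A != set0 -> exists2 x, x \in A & forall y, y \in A -> y <= x.
Proof.
case/set0Pn=> x0 x0A.
case: (@arg_maxnP _ x0 (mem A) (fun i : 'I_N => i : nat) x0A) => x xA xmax.
by exists x => // y yA; apply: xmax.
Qed.

Lemma set_max_unique A (x y : 'I_N) : x \in A -> (forall z, z \in A -> z <= x) ->
  y \in A -> (forall z, z \in A -> z <= y) -> x = y.
Proof. by move=> xA xmax yA ymax; apply/val_inj/anti_leq; rewrite xmax ?ymax. Qed.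

Lemma subset_ltP A B :
  reflect (exists x, [/\ x \in B, x \notin A
                       & forall y : 'I_N, x < y -> (y \in A) = (y \in B)])
          (subset_lt A B).
Proof.
apply: (iffP exists_inP) => [[x xD /andP[/forall_inP xmax xB]] | [x [xB xA xmax]]].
  exists x; split=> // [|y lt_xy].
    by move: xD; rewrite !inE xB /= andbT.
  case: (boolP (y \in (A :\: B) :|: (B :\: A))) => [/xmax|].
    by rewrite leqNgt lt_xy.
  by rewrite !inE; case: (y \in A); case: (y \in B).
exists x; first by rewrite !inE xB xA.
rewrite xB andbT; apply/forall_inP=> y yD; rewrite leqNgt; apply/negP=> /xmax eqAB.
by move: yD; rewrite !inE eqAB; case: (y \in B).
Qed.

Lemma subset_lt_irr A : ~~ subset_lt A A.
Proof. by apply/negP=> /subset_ltP[x [-> ]]. Qed.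

Lemma subset_lt_trans A B C : subset_lt A B -> subset_lt B C -> subset_lt A C.
Proof.
case/subset_ltP=> x [xB xA xmax] /subset_ltP[y [yC yB ymax]]; apply/subset_ltP.
case: (ltngtP x y) => [lt_xy | lt_yx | /val_inj eq_xy].
- exists y; split=> // [|z lt_yz]; first by rewrite xmax.
  by rewrite xmax ?ymax // (ltn_trans lt_xy).
- exists x; split=> // [|z lt_xz]; first by rewrite -ymax.
  by rewrite xmax ?ymax // (ltn_trans lt_yx).
- by move: yB; rewrite -eq_xy xB.
Qed.

Lemma subset_lt_total A B : A != B -> subset_lt A B \/ subset_lt B A.
Proof.
move=> neqAB; have: (A :\: B) :|: (B :\: A) != set0.
  apply: contra neqAB => /eqP D0; apply/eqP/setP=> x.
  by move/setP/(_ x): D0; rewrite !inE; case: (x \in A); case: (x \in B).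
case/set_max_exists=> x xD xmax.
have eqAB (y : 'I_N) : x < y -> (y \in A) = (y \in B).
  move=> lt_xy; case: (boolP (y \in (A :\: B) :|: (B :\: A))) => [/xmax|].
    by rewrite leqNgt lt_xy.
  by rewrite !inE; case: (y \in A); case: (y \in B).
by move: xD; rewrite !inE => /orP[] /andP[nx x_in]; [right | left];
  apply/subset_ltP; exists x; split=> // y /eqAB ->.
Qed.

Lemma proper_subset_lt A B : A \proper B -> subset_lt A B.
Proof.
move=> /andP[/subsetP sAB nsBA]; have: B :\: A != set0 by rewrite setD_eq0.
case/set_max_exists=> x /setDP[xB xA] xmax; apply/subset_ltP; exists x; split=> // y lt_xy.
apply/idP/idP=> [/sAB // | yB]; apply: contraLR lt_xy => yA.
by rewrite -leqNgt xmax // inE yB yA.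
Qed.

Lemma subset_lt_swap A (a c : 'I_N) : c < a -> a \notin A -> c \notin A ->
  subset_lt (c |: A) (a |: A).
Proof.
move=> lt_ca aA cA; apply/subset_ltP; exists a.
split; first by rewrite !inE eqxx.
  by rewrite !inE (negPf aA) orbF -val_eqE /= gtn_eqF.
move=> y lt_ay; have lt_cy := ltn_trans lt_ca lt_ay.
by rewrite !inE -!val_eqE /= !gtn_eqF.
Qed.

End SubsetOrder.

Section BinaryTrees.

Variable N : nat.
Implicit Types (T U : btree N) (A B C : {set 'I_N}).

Lemma leaf_set_Leaf (i : 'I_N) : leaf_set (Leaf i) = [set i].
Proof. by apply/setP=> j; rewrite !inE. Qed.

Lemma leaf_set_Node T U : leaf_set (Node T U) = leaf_set T :|: leaf_set U.
Proof. by apply/setP=> j; rewrite !inE mem_cat. Qed.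

Definition leaf_setE := (leaf_set_Leaf, leaf_set_Node).

Lemma leaf_set_neq0 T : leaf_set T != set0.
Proof.
elim: T => [i|T0 IH0 T1 _]; rewrite leaf_setE; last by rewrite setU_eq0 negb_and IH0.
by apply/set0Pn; exists i; rewrite inE.
Qed.

Definition canonical T := uniq (leaves T) && max_in_second T.

Lemma canonical_Node T U :
  canonical (Node T U) =
  [&& canonical T, canonical U, [disjoint leaf_set T & leaf_set U]
    & [exists x in leaf_set U, [forall y in leaf_set T :|: leaf_set U, y <= x]]].
Proof.
rewrite /canonical -leaf_set_Node /= cat_uniq.
have -> : [disjoint leaf_set T & leaf_set U] = ~~ has (mem (leaves T)) (leaves U).
  rewrite disjoint_sym disjoint_subset; apply/subsetP/hasPn => h x.
    by move=> xU; have := h x; rewrite !inE; apply.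
  by rewrite !inE => /h.
by case: (uniq _); case: (max_in_second T); case: (uniq _);
   case: (max_in_second U); case: (has _ _); rewrite /= ?andbF ?andbT.
Qed.

Lemma in_internal_clusters_Node A T0 T1 :
  (A \in internal_clusters (Node T0 T1)) =
  [|| A == leaf_set (Node T0 T1), A \in internal_clusters T0 | A \in internal_clusters T1].
Proof. by rewrite /= in_setU1 in_setU. Qed.

Lemma internal_cluster_sub T A : A \in internal_clusters T -> A \subset leaf_set T.
Proof.
elim: T => [i|T0 IH0 T1 IH1] /=; first by rewrite inE.
rewrite !inE => /or3P[/eqP -> // | /IH0 | /IH1] /subset_trans -> //;
  by rewrite leaf_setE ?subsetUl ?subsetUr.
Qed.

Lemma internal_cluster_neq0 T A : A \in internal_clusters T -> A != set0.
Proof.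
elim: T => [i|T0 IH0 T1 IH1] /=; first by rewrite inE.
by rewrite !inE => /or3P[/eqP -> | /IH0 | /IH1] //; apply: leaf_set_neq0.
Qed.

Lemma internal_cluster_root T0 T1 : leaf_set (Node T0 T1) \in internal_clusters (Node T0 T1).
Proof. by rewrite /= !inE eqxx. Qed.

Lemma disjoint_mem A B x : [disjoint A & B] -> x \in A -> x \notin B.
Proof. by move=> dAB xA; rewrite (disjointFr dAB xA). Qed.

Lemma nonempty_sub_disjoint A B C :
  A != set0 -> A \subset B -> [disjoint B & C] -> ~~ (A \subset C).
Proof.
case/set0Pn=> x xA /subsetP sAB dBC; apply/negP=> /subsetP /(_ x xA).
exact/negP/(disjoint_mem dBC)/sAB.
Qed.

Lemma leaf_set_proper T0 T1 : canonical (Node T0 T1) ->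
  leaf_set T0 \proper leaf_set (Node T0 T1) /\ leaf_set T1 \proper leaf_set (Node T0 T1).
Proof.
rewrite canonical_Node => /and4P[_ _ dT _]; rewrite leaf_setE !properE subsetUl subsetUr /=.
have dT' : [disjoint leaf_set T1 & leaf_set T0] by rewrite disjoint_sym.
split; apply/negP=> /(subset_trans _); [move/(_ _ (subsetUr _ _)) | move/(_ _ (subsetUl _ _))].
  exact/negP/(nonempty_sub_disjoint (leaf_set_neq0 _) _ dT').
exact/negP/(nonempty_sub_disjoint (leaf_set_neq0 _) _ dT).
Qed.

Lemma internal_clusters_subl T0 T1 A : canonical (Node T0 T1) ->
  A \in internal_clusters (Node T0 T1) -> A \subset leaf_set T0 -> A \in internal_clusters T0.
Proof.
move=> cT; have [pT0 _] := leaf_set_proper cT.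
move: cT; rewrite canonical_Node => /and4P[_ _ dT _].
rewrite [internal_clusters _]/= !inE => /or3P[/eqP -> | // | AT1] sA.
  by move: pT0; rewrite properE sA andbF.
rewrite disjoint_sym in dT.
by case/negP: (nonempty_sub_disjoint (internal_cluster_neq0 AT1) (internal_cluster_sub AT1) dT).
Qed.

Lemma internal_clusters_subr T0 T1 A : canonical (Node T0 T1) ->
  A \in internal_clusters (Node T0 T1) -> A \subset leaf_set T1 -> A \in internal_clusters T1.
Proof.
move=> cT; have [_ pT1] := leaf_set_proper cT.
move: cT; rewrite canonical_Node => /and4P[_ _ dT _].
rewrite [internal_clusters _]/= !inE => /or3P[/eqP -> | AT0 | //] sA.
  by move: pT1; rewrite properE sA andbF.
by case/negP: (nonempty_sub_disjoint (internal_cluster_neq0 AT0) (internal_cluster_sub AT0) dT).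
Qed.

Lemma proper_internal_clusters T0 T1 : canonical (Node T0 T1) ->
  internal_clusters (Node T0 T1) :\ leaf_set (Node T0 T1) =
  internal_clusters T0 :|: internal_clusters T1.
Proof.
move=> /leaf_set_proper[p0 p1]; apply/setP=> A; rewrite [internal_clusters _]/= !inE.
case: eqP => //= ->; apply/esym/negP=> /orP[] /internal_cluster_sub sA.
  by move: p0; rewrite properE sA andbF.
by move: p1; rewrite properE sA andbF.
Qed.

Lemma canonical_join T U : canonical T -> canonical U ->
    [disjoint leaf_set T & leaf_set U] ->
  exists J, [/\ canonical J, leaf_set J = leaf_set T :|: leaf_set U
    & internal_clusters J =
      (leaf_set T :|: leaf_set U) |: (internal_clusters T :|: internal_clusters U)].
Proof.
move=> cT cU dTU; have: leaf_set T :|: leaf_set U != set0.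
  by rewrite setU_eq0 negb_and leaf_set_neq0.
case/set_max_exists=> x; rewrite inE => xTU xmax; case/orP: xTU => [xT | xU].
  exists (Node U T); rewrite canonical_Node cT cU disjoint_sym dTU /= leaf_setE setUC.
  rewrite [internal_clusters U :|: _]setUC; split=> //; apply/exists_inP; exists x => //.
  by apply/forall_inP.
exists (Node T U); rewrite canonical_Node cT cU dTU /= leaf_setE.
split=> //; apply/exists_inP; exists x => //.
by apply/forall_inP.
Qed.

Definition laminar A B := [|| A \subset B, B \subset A | [disjoint A & B]].

Lemma laminarC A B : laminar A B = laminar B A.
Proof. by rewrite /laminar disjoint_sym orbCA. Qed.

Lemma internal_clusters_laminar T A B : canonical T ->
  A \in internal_clusters T -> B \in internal_clusters T -> laminar A B.
Proof.
elim: T => [i|T0 IH0 T1 IH1]; first by rewrite inE.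
move=> cT AT BT; have sA := internal_cluster_sub AT; have sB := internal_cluster_sub BT.
move: cT AT BT; rewrite canonical_Node => /and4P[c0 c1 dT _] /=.
rewrite !inE /laminar => /or3P[/eqP -> | A0 | A1]; first by rewrite sB orbT.
  case/or3P=> [/eqP -> | B0 | B1]; [by rewrite sA | exact: IH0 |].
  rewrite (disjointWl (internal_cluster_sub A0)) ?orbT //.
  by rewrite (disjointWr (internal_cluster_sub B1)).
case/or3P=> [/eqP -> | B0 | B1]; [by rewrite sA | | exact: IH1].
rewrite disjoint_sym (disjointWl (internal_cluster_sub B0)) ?orbT //.
by rewrite (disjointWr (internal_cluster_sub A1)).
Qed.

Lemma internal_clusters_maximal T A : 1 < #|A| -> A \subset leaf_set T ->
    (forall B, B \in internal_clusters T -> laminar A B) ->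
  A \in internal_clusters T.
Proof.
move=> A2; have An0 : A != set0 by rewrite -card_gt0 ltnW.
elim: T => [i|T0 IH0 T1 IH1].
  by rewrite leaf_setE => /subset_leq_card; rewrite cards1 leqNgt A2.
rewrite leaf_setE => sA lamA; rewrite /= !inE.
have lam_child U : (forall B, B \in internal_clusters U -> laminar A B) ->
    laminar A (leaf_set U).
  case: U => [i _|U V]; last by apply; apply: internal_cluster_root.
  by rewrite leaf_setE /laminar sub1set [X in _ || (_ || X)]disjoint_sym disjoints1 orbN orbT.
have lam0 B : B \in internal_clusters T0 -> laminar A B.
  by move=> B0; apply: lamA; rewrite /= !inE B0 !orbT.
have lam1 B : B \in internal_clusters T1 -> laminar A B.
  by move=> B1; apply: lamA; rewrite /= !inE B1 !orbT.
have [A0|nA0] := boolP (A \subset leaf_set T0); first by rewrite IH0 ?orbT.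
have [A1|nA1] := boolP (A \subset leaf_set T1); first by rewrite IH1 ?orbT.
have := lam_child _ lam0; have := lam_child _ lam1.
rewrite /laminar (negPf nA0) (negPf nA1) /=.
have sub_of (X Y : {set 'I_N}) : A \subset X :|: Y -> [disjoint A & X] -> A \subset Y.
  move=> /subsetP sXY dAX; apply/subsetP=> x xA; have := sXY x xA.
  by rewrite inE (negPf (disjoint_mem dAX xA)).
move=> /orP[s1A | dA1]; last first.
  by move: nA0; rewrite (sub_of (leaf_set T1)) // setUC.
move=> /orP[s0A | dA0]; last first.
  by move: nA1; rewrite (sub_of (leaf_set T0)).
by rewrite leaf_setE eqEsubset sA subUset s0A s1A.
Qed.

Lemma card_internal_clusters T : canonical T -> #|internal_clusters T|.+1 = #|leaf_set T|.
Proof.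
elim: T => [i|T0 IH0 T1 IH1] cT; first by rewrite leaf_setE cards0 cards1.
have eqD := proper_internal_clusters cT.
rewrite (cardsD1 (leaf_set (Node T0 T1))) internal_cluster_root eqD.
move: cT; rewrite canonical_Node => /and4P[c0 c1 dT _].
rewrite leaf_setE !cardsU (disjoint_setI0 dT) -IH0 // -IH1 //.
have -> : internal_clusters T0 :&: internal_clusters T1 = set0.
  apply/setP=> A; rewrite !inE; apply/negP=> /andP[A0 A1].
  by case/negP: (nonempty_sub_disjoint (internal_cluster_neq0 A0) (internal_cluster_sub A0) dT);
     apply: internal_cluster_sub.
by rewrite !cards0 !subn0 addnS.
Qed.

End BinaryTrees.

Section TreeOrder.

Variable N : nat.
Implicit Types (T U : btree N) (A B : {set 'I_N}).

Lemma tree_lt_irr T : ~ tree_lt T T.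
Proof.
elim: T => [i []|T0 IH0 T1 IH1 /= [|[_ /IH1]|[_ _ /IH0]]] //.
exact/negP/subset_lt_irr.
Qed.

Lemma tree_lt_trans T1 T2 T3 : tree_lt T1 T2 -> tree_lt T2 T3 -> tree_lt T1 T3.
Proof.
elim: T1 T2 T3 => [i|A IHA B IHB] [j|A2 B2] [k|A3 B3] //=.
move=> [lt12|[eq12 lt12]|[eq12 -> lt12]]; move=> [lt23|[eq23 lt23]|[eq23 eB lt23]].
- by constructor 1; apply: subset_lt_trans lt12 lt23.
- by constructor 1; rewrite -eq23.
- by constructor 1; rewrite -eq23.
- by constructor 1; rewrite eq12.
- by constructor 2; rewrite eq12; split=> //; apply: IHB lt12 lt23.
- by constructor 2; rewrite eq12; split=> //; rewrite -eB.
- by constructor 1.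
- by constructor 2.
- by constructor 3; split=> //; apply: IHA lt12 lt23.
Qed.

Lemma disjoint_setU_inj A B (X Y : {set 'I_N}) :
  [disjoint A & X] -> [disjoint B & Y] -> A :|: X = B :|: Y -> X = Y -> A = B.
Proof.
move=> dAX dBY eqU eqXY; apply/setP=> x; have /setP/(_ x) := eqU; rewrite !inE -eqXY.
case: (boolP (x \in X)) => [xX _|]; last by rewrite !orbF.
rewrite disjoint_sym in dAX; rewrite disjoint_sym in dBY.
by rewrite (negPf (disjoint_mem dAX xX)) (negPf (disjoint_mem dBY _)) // -eqXY.
Qed.

Lemma leaf_set_Leaf_Node i T0 T1 :
  canonical (Node T0 T1) -> leaf_set (Leaf i) = leaf_set (Node T0 T1) -> False.
Proof.
move=> /card_internal_clusters c2 eqL; move: c2; rewrite -eqL leaf_setE cards1 => /eqP.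
by rewrite eqSS cards_eq0 => /eqP/setP/(_ (leaf_set (Node T0 T1))); rewrite internal_cluster_root inE.
Qed.

Lemma tree_eq_dec T U : {T = U} + {T <> U}.
Proof. by decide equality; apply: eq_comparable. Qed.

Lemma tree_lt_total T U : canonical T -> canonical U -> leaf_set T = leaf_set U ->
  T <> U -> tree_lt T U \/ tree_lt U T.
Proof.
elim: T U => [i|T0 IH0 T1 IH1] [j|U0 U1] cT cU.
- by rewrite !leaf_setE => /set1_inj ->.
- by move/(leaf_set_Leaf_Node cU).
- by move/esym/(leaf_set_Leaf_Node cT).
move: cT cU; rewrite !canonical_Node => /and4P[cT0 cT1 dT _] /and4P[cU0 cU1 dU _].
rewrite !leaf_setE => eqL neqTU.
have [eq1|] := eqVneq (leaf_set T1) (leaf_set U1); last first.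
  by case/subset_lt_total => ?; [left | right]; constructor 1.
have eq0 := disjoint_setU_inj dT dU eqL eq1.
have [lt_or|eqTU1] : (tree_lt T1 U1 \/ tree_lt U1 T1) \/ T1 = U1.
- by have := IH1 _ cT1 cU1 eq1; case: (tree_eq_dec T1 U1); [right | left; auto].
- by case: lt_or => ?; [left | right]; constructor 2.
have /IH0 : T0 <> U0 by move=> eqTU0; apply: neqTU; rewrite eqTU0 eqTU1.
by case=> // ?; [left | right]; constructor 3.
Qed.

End TreeOrder.

Section Flips.

Variables (N : nat) (X : eqType) (col : 'I_N -> X).
Implicit Types (T U : btree N) (A B S : {set 'I_N}) (H : {set {set 'I_N}}).

(* Unlike [inE], this does not unfold [leaf_set]. *)
Local Definition in_setE := (in_setU, in_set1, in_setC, in_setD1, in_set0).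

Definition polychrome A := [exists x in A, exists y in A, col x != col y].

Lemma polychromeP A :
  reflect (exists x y, [/\ x \in A, y \in A & col x != col y]) (polychrome A).
Proof.
apply: (iffP exists_inP) => [[x xA /exists_inP[y yA xy]] | [x [y [xA yA xy]]]].
  by exists x, y.
by exists x => //; apply/exists_inP; exists y.
Qed.

Lemma polychrome_sub A B : A \subset B -> polychrome A -> polychrome B.
Proof.
by move=> /subsetP sAB /polychromeP[x [y [/sAB xB /sAB yB xy]]]; apply/polychromeP; exists x, y.
Qed.

Lemma polychrome_neq A c : polychrome A -> exists2 x, x \in A & col x != c.
Proof.
case/polychromeP=> x [y [xA yA xy]]; have [eq_xc|] := eqVneq (col x) c; last by exists x.
by exists y; rewrite // -eq_xc eq_sym.
Qed.

Lemma polychrome_card A : polychrome A -> 1 < #|A|.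
Proof.
case/polychromeP=> x [y [xA yA xy]]; apply/card_gt1P; exists x, y; split=> //.
by apply: contra xy => /eqP ->.
Qed.

Lemma polychrome_swap (a c : 'I_N) A B : col a = col c ->
  A \subset a |: B -> polychrome A -> polychrome (c |: B).
Proof.
move=> eq_ac /subsetP sAB /polychromeP[x [y [/sAB xA /sAB yA xy]]].
have repr z : z \in a |: B -> exists2 z', z' \in c |: B & col z' = col z.
  rewrite !in_setE => /orP[/eqP -> | zB]; first by exists c; rewrite ?setU11.
  by exists z; rewrite ?in_setE ?zB ?orbT.
have [[x' x'B ex] [y' y'B ey]] := (repr x xA, repr y yA).
by apply/polychromeP; exists x', y'; rewrite ex ey.
Qed.

(* The exceptional configurations are those where neither flip of the edge above
   [Node A B] yields a smaller tree without monochromatic clusters. *)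
Definition blocked (T0 A : btree N) :=
  if (T0, A) is (Leaf c, Leaf a) then (a < c) && (col a == col c) else false.

Fixpoint rigid H T :=
  if T is Node T0 T1 then
    [&& rigid H T0, rigid H T1
      & if T1 is Node A B then (leaf_set T1 \in H) || blocked T0 A else true]
  else true.

Lemma rigid_clusters H T : internal_clusters T \subset H -> rigid H T.
Proof.
elim: T => [//|T0 IH0 T1 IH1]; rewrite [internal_clusters _]/= !subUset => /and3P[_ s0 s1].
rewrite /= IH0 // IH1 //; case: T1 s1 {IH1} => //= A B.
by rewrite subUset sub1set => /andP[-> ].
Qed.

Lemma rigid_chain H S (c : 'I_N) U (m : 'I_N) :
    canonical U -> rigid H (Node (Leaf c) U) ->
    m \in S -> m \in leaf_set U -> (forall y, y \in leaf_set U -> y <= m) ->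
    (forall A, A \in H -> m \in A -> A \subset leaf_set U -> A \subset S) ->
  forall x, x \in leaf_set U -> x \notin S -> col x = col c /\ x < c.
Proof.
move=> cU rU mS mU mmax HS.
elim: U c cU rU mU mmax HS => [i|A _ B IH] c.
  by move=> _ _; rewrite leaf_setE in_setE => /eqP <- _ _ x /set1P -> /negP.
move=> cAB /and3P[_ rAB].
move=> /orP[ABH | bl] mAB mmax HS x xAB xS.
  by case/negP: xS; apply: (subsetP (HS _ ABH mAB _)).
case: A cAB rAB bl mAB mmax HS xAB => // a cAB rAB /andP[lt_ac /eqP eq_ac] mAB mmax HS xAB.
move: (cAB); rewrite canonical_Node => /and4P[_ cB daB /exists_inP[m' m'B /forall_inP m'max]].
have eq_m : m' = m.
  apply: (@set_max_unique _ (leaf_set (Node (Leaf a) B))) => //; rewrite leaf_setE //.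
  by rewrite in_setU m'B orbT.
rewrite eq_m in m'B.
move: xAB; rewrite leaf_setE leaf_set_Leaf !in_setE => /orP[/eqP -> // | xB].
have [] := IH a cB rAB m'B _ _ x xB xS.
- by move=> y yB; apply: mmax; rewrite leaf_setE in_setE yB orbT.
- by move=> D DH mD sDB; apply: HS; rewrite // leaf_setE (subset_trans sDB) ?subsetUr.
by rewrite eq_ac => -> /ltn_trans ->.
Qed.

Lemma rigid_le H T T' : canonical T -> canonical T' -> leaf_set T = leaf_set T' ->
    (forall A, A \in internal_clusters T' -> polychrome A) ->
    (forall A, A \in H -> A \subset leaf_set T' -> A \in internal_clusters T') ->
    rigid H T -> T = T' \/ tree_lt T T'.
Proof.
elim: T T' => [i|T0 IH0 T1 IH1] [j|T0' T1'] cT cT'.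
- by rewrite !leaf_setE => /set1_inj -> *; left.
- by move/(leaf_set_Leaf_Node cT').
- by move/esym/(leaf_set_Leaf_Node cT).
move=> eqL polyT' HT' rT.
have [pT0' pT1'] := leaf_set_proper cT'; have [pT0 pT1] := leaf_set_proper cT.
have := cT; have := cT'; rewrite !canonical_Node.
move=> /and4P[c0' c1' d' /exists_inP[m' m'T1' /forall_inP m'max]].
move=> /and4P[c0 c1 dT /exists_inP[m mT1 /forall_inP mmax]].
rewrite -!leaf_set_Node in mmax m'max.
have eq_m : m' = m.
  apply: (@set_max_unique _ (leaf_set (Node T0 T1))) => //; rewrite ?eqL //.
    by rewrite leaf_setE in_setU m'T1' orbT.
  by rewrite -eqL leaf_setE in_setU mT1 orbT.
rewrite {}eq_m in m'T1' m'max.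
have HS A : A \in H -> m \in A -> A \subset leaf_set T1 -> A \subset leaf_set T1'.
  move=> AH mA sA.
  have pA : A \proper leaf_set (Node T0' T1') by rewrite -eqL; apply: sub_proper_trans pT1.
  have := HT' A AH (proper_sub pA); rewrite [internal_clusters _]/= !in_setE.
  case/or3P=> [/eqP eqA | /internal_cluster_sub /subsetP/(_ m mA) mT0' | /internal_cluster_sub //].
    by move: pA; rewrite eqA properxx.
  by move: (disjoint_mem d' mT0'); rewrite m'T1'.
have [eq1 | lt1] : leaf_set T1 = leaf_set T1' \/ subset_lt (leaf_set T1) (leaf_set T1').
- have le_sub : leaf_set T1 \subset leaf_set T1' ->
      leaf_set T1 = leaf_set T1' \/ subset_lt (leaf_set T1) (leaf_set T1').
    rewrite subEproper => /orP[/eqP | /proper_subset_lt]; by [left | right].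
  have [//|] := boolP (leaf_set T1 \subset leaf_set T1') => /subsetPn[x xT1 xT1'].
  have [c eqT0] : exists c, T0 = Leaf c.
    case: T1 rT mT1 HS xT1 {IH1 cT eqL pT0 pT1 c1 dT mmax le_sub} => [i|A B].
      move=> _ + _; rewrite leaf_setE => /set1P <- /set1P eq_x.
      by move: xT1'; rewrite eq_x m'T1'.
    move=> /and3P[_ _ /orP[ABH | bl]] mT1 HS xT1.
      by move: xT1'; rewrite (subsetP (HS _ ABH mT1 (subxx _)) x xT1).
    by move: bl; rewrite /blocked; case: (T0) => // c _; exists c.
  move: eqT0 => ?; subst T0.
  have lt_c y : y \in leaf_set T1 -> y \notin leaf_set T1' -> col y = col c /\ y < c.
    apply: (rigid_chain c1 rT m'T1' mT1) => // z zT1.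
    by apply: mmax; rewrite leaf_setE in_setE zT1 orbT.
  have col0 y : y \in leaf_set T0' -> col y = col c.
    move=> yT0'; have : y \in leaf_set (Node (Leaf c) T1) by rewrite eqL leaf_setE in_setE yT0'.
    rewrite leaf_setE leaf_set_Leaf !in_setE => /orP[/eqP -> // | yT1].
    by case: (lt_c y yT1 (disjoint_mem d' yT0')).
  case: T0' c0' cT' d' eqL pT0' pT1' polyT' HT' m'max col0 => [y | U V]; last first.
    move=> _ _ _ _ _ _ polyT' _ _ col0.
    have /polyT'/polychromeP[u [v [/col0 -> /col0 ->]]] :
        leaf_set (Node U V) \in internal_clusters (Node (Node U V) T1').
      by rewrite /= !in_setE eqxx orbT.
    by rewrite eqxx.
  move=> _ cT' d' eqL _ _ _ _ _ col0.
  rewrite !leaf_setE in eqL; rewrite leaf_setE disjoints1 in d'.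
  rewrite leaf_setE disjoints1 in dT.
  have eq_x : x = y.
    have : x \in [set c] :|: leaf_set T1 by rewrite in_setE xT1 orbT.
    by rewrite eqL !in_setE (negPf xT1') orbF => /eqP.
  have lt_yc : y < c by rewrite -eq_x; case: (lt_c x).
  right; have -> : leaf_set T1 = y |: (leaf_set T1 :\ y) by rewrite setD1K // -eq_x.
  have -> : leaf_set T1' = c |: (leaf_set T1 :\ y).
    apply/setP=> z; have /setP/(_ z) := eqL; rewrite !in_setE.
    have [-> | ] := eqVneq z y; first by rewrite (negPf d') -val_eqE /= ltn_eqF.
    by rewrite /= => _ <-.
  by apply: subset_lt_swap; rewrite // !in_setE ?eqxx // (negPf dT) andbF.
- have eq0 : leaf_set T0 = leaf_set T0'.
    by apply: disjoint_setU_inj dT d' _ eq1; rewrite -!leaf_set_Node.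
  have HT0' A : A \in H -> A \subset leaf_set T0' -> A \in internal_clusters T0'.
    move=> AH sA; apply: (internal_clusters_subl cT') => //; apply: HT' => //.
    exact: subset_trans sA (proper_sub pT0').
  have HT1' A : A \in H -> A \subset leaf_set T1' -> A \in internal_clusters T1'.
    move=> AH sA; apply: (internal_clusters_subr cT') => //; apply: HT' => //.
    exact: subset_trans sA (proper_sub pT1').
  have poly0 A : A \in internal_clusters T0' -> polychrome A.
    by move=> A0; apply: polyT'; rewrite /= !in_setE A0 !orbT.
  have poly1 A : A \in internal_clusters T1' -> polychrome A.
    by move=> A1; apply: polyT'; rewrite /= !in_setE A1 !orbT.
  case/and3P: rT => r0 r1 _.
  have [-> | lt1] := IH1 _ c1 c1' eq1 poly1 HT1' r1; last by right; constructor 2.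
  have [-> | lt0] := IH0 _ c0 c0' eq0 poly0 HT0' r0; first by left.
  by right; constructor 3.
by right; constructor 1.
Qed.

Lemma flip H T : canonical T ->
    (forall A, A \in internal_clusters T -> polychrome A) ->
    (forall A, A \in internal_clusters T -> A != leaf_set T -> polychrome (~: A)) ->
    (forall m, m \in leaf_set T -> (forall y, y \in leaf_set T -> y <= m) ->
       exists2 z, z \notin leaf_set T & col z != col m) ->
    ~~ rigid H T ->
  exists T'' S,
    [/\ [/\ canonical T'', leaf_set T'' = leaf_set T & tree_lt T'' T],
        [/\ S \in internal_clusters T, S != leaf_set T & S \notin H],
        internal_clusters T :\ S \subset internal_clusters T''
      & forall A, A \in internal_clusters T'' ->
          A \in internal_clusters T \/ polychrome A /\ polychrome (~: A)].
Proof.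
elim: T => [//|T0 IH0 T1 IH1] cT polyT copolyT maxT nrT.
have [p0 p1] := leaf_set_proper cT.
have := cT; rewrite canonical_Node => /and4P[c0 c1 dT /exists_inP[m mT1 /forall_inP mmax]].
have in0 A : A \in internal_clusters T0 -> A \in internal_clusters (Node T0 T1).
  by move=> A0; rewrite !in_internal_clusters_Node A0 !orbT.
have in1 A : A \in internal_clusters T1 -> A \in internal_clusters (Node T0 T1).
  by move=> A1; rewrite !in_internal_clusters_Node A1 !orbT.
have copoly0 A : A \in internal_clusters T0 -> polychrome (~: A).
  move=> A0; apply: copolyT; first exact: in0.
  by apply: contraTneq p0 => <-; rewrite properE (internal_cluster_sub A0) andbF.
have copoly1 A : A \in internal_clusters T1 -> polychrome (~: A).
  move=> A1; apply: copolyT; first exact: in1.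
  by apply: contraTneq p1 => <-; rewrite properE (internal_cluster_sub A1) andbF.
have max_sub U : (forall A, A \in internal_clusters U -> polychrome (~: A)) ->
    ~~ rigid H U -> forall m, m \in leaf_set U -> (forall y, y \in leaf_set U -> y <= m) ->
    exists2 z, z \notin leaf_set U & col z != col m.
  case: U => // U V /(_ _ (internal_cluster_root U V)) /polychrome_neq pn _ m' _ _.
  by have [z] := pn (col m'); rewrite in_setE; exists z.
have [r0 | nr0] := boolP (rigid H T0); last first.
  have [|A|||T0'' [S [[c0'' eqL lt0] [S0 SL SH] sub0 new0]]] := IH0 c0 => //.
  - by move=> A /in0 /polyT.
  - by move=> /copoly0.
  - exact: max_sub copoly0 nr0.
  exists (Node T0'' T1), S; split.
  - split; [|by rewrite !leaf_setE eqL|by constructor 3].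
    rewrite canonical_Node c0'' c1 eqL dT /=; apply/exists_inP; exists m => //.
    exact/forall_inP.
  - split=> //; first exact: in0.
    by apply: contraTneq p0 => <-; rewrite properE (internal_cluster_sub S0) andbF.
  - apply/subsetP=> A; rewrite in_setD1 !in_internal_clusters_Node.
    rewrite !leaf_setE eqL => /andP[neqAS /or3P[-> // | A0 | ->]]; last by rewrite !orbT.
    by rewrite (subsetP sub0) ?orbT // in_setD1 A0 neqAS.
  - move=> A; rewrite in_internal_clusters_Node leaf_setE eqL -leaf_set_Node.
    case/or3P=> [/eqP -> | /new0[/in0 | ] | /in1].
        + by left; apply: internal_cluster_root.
    + by left.
    + by right.
    + by left.
have [r1 | nr1] := boolP (rigid H T1); last first.
  have [|A|||T1'' [S [[c1'' eqL lt1] [S1 SL SH] sub1 new1]]] := IH1 c1 => //.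
  - by move=> A /in1 /polyT.
  - by move=> /copoly1.
  - exact: max_sub copoly1 nr1.
  exists (Node T0 T1''), S; split.
  - split; [|by rewrite !leaf_setE eqL|by constructor 2].
    rewrite canonical_Node c1'' c0 eqL dT /=; apply/exists_inP; exists m => //.
    exact/forall_inP.
  - split=> //; first exact: in1.
    by apply: contraTneq p1 => <-; rewrite properE (internal_cluster_sub S1) andbF.
  - apply/subsetP=> A; rewrite in_setD1 !in_internal_clusters_Node.
    rewrite !leaf_setE eqL => /andP[neqAS /or3P[-> // | -> | A1]]; first by rewrite !orbT.
    by rewrite (subsetP sub1) ?orbT // in_setD1 A1 neqAS.
  - move=> A; rewrite in_internal_clusters_Node leaf_setE eqL -leaf_set_Node.
    case/or3P=> [/eqP -> | /in0 | /new1[/in1 | ]].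
    + by left; apply: internal_cluster_root.
    + by left.
    + by left.
    + by right.
move: nrT; rewrite [rigid _ _]/= r0 r1 /=.
case: T1 IH1 cT polyT copolyT maxT p1 c1 dT mT1 mmax in0 in1 copoly1 {r1 IH0 p0} => // A B.
set V := Node A B => _ cT polyT copolyT maxT p1 cAB dT mT1 mmax in0 in1 copoly1.
rewrite negb_or => /andP[VH nbl].
have [pA pB] := leaf_set_proper cAB.
have := cAB; rewrite canonical_Node => /and4P[cA cB dAB /exists_inP[m' m'B /forall_inP m'max]].
have eq_m : m' = m.
  apply: (@set_max_unique _ (leaf_set V)) => //; rewrite ?leaf_setE //.
    by rewrite in_setU m'B orbT.
  by move=> y yV; apply: mmax; rewrite leaf_setE in_setU yV orbT.
rewrite {m' m'max}eq_m in m'B.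
have eqV : leaf_set V = leaf_set A :|: leaf_set B := leaf_set_Node A B.
have := dT; rewrite eqV => dT'.
have dTA : [disjoint leaf_set T0 & leaf_set A] := disjointWr (subsetUl _ _) dT'.
have dTB : [disjoint leaf_set T0 & leaf_set B] := disjointWr (subsetUr _ _) dT'.
have [z zL col_z] : exists2 z, z \notin leaf_set (Node T0 V) & col z != col m.
  apply: maxT => [|y]; first by rewrite leaf_setE in_setE mT1 orbT.
  by rewrite leaf_setE; apply: mmax.
have memL y : (y \in leaf_set (Node T0 V)) =
    [|| y \in leaf_set T0, y \in leaf_set A | y \in leaf_set B].
  by rewrite leaf_setE eqV !in_setE.
have zN0 : [/\ z \notin leaf_set T0, z \notin leaf_set A & z \notin leaf_set B].
  by move: zL; rewrite memL !negb_or => /and3P[].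
have SV : [/\ leaf_set V \in internal_clusters (Node T0 V),
    leaf_set V != leaf_set (Node T0 V) & leaf_set V \notin H].
  by split=> //; [apply/in1/internal_cluster_root | rewrite proper_neq].
have [pAC | npAC] := boolP (polychrome (leaf_set A :|: leaf_set T0)).
  have [|J [cJ eqJ clJ]] := canonical_join cA c0; first by rewrite disjoint_sym.
  have eqL : leaf_set (Node J B) = leaf_set (Node T0 V).
    by rewrite !leaf_setE eqJ -setUA setUCA.
  exists (Node J B), (leaf_set V); split=> //.
  - split=> //; last by constructor 1; apply: proper_subset_lt.
    rewrite canonical_Node cJ cB eqJ 2!andTb; apply/andP; split.
      by rewrite -setI_eq0 setIUl (disjoint_setI0 dAB) (disjoint_setI0 dTB) setU0.
    apply/exists_inP; exists m => //; apply/forall_inP=> y yL; apply: mmax.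
    by rewrite -leaf_set_Node -/V -eqL leaf_setE eqJ.
  - apply/subsetP=> D; rewrite in_setD1 !in_internal_clusters_Node clJ eqL !in_setE.
    by case: eqP => //= _ /or4P[] ->; rewrite ?orbT.
  - move=> D; rewrite in_internal_clusters_Node clJ eqL in_setU1 in_setU.
    case/or3P=> [/eqP -> | /or3P[/eqP -> | DA | /in0 D0] | DB]; try by left.
    + by left; apply: internal_cluster_root.
    + right; split=> //; apply/polychromeP; exists z, m; case: zN0 => z0 zA zB.
      rewrite !in_setE (negPf z0) (negPf zA) (disjointFl dAB m'B) (disjointFl dTB m'B).
      by split.
    + by left; apply: in1; rewrite !in_internal_clusters_Node DA !orbT.
    + by left; apply: in1; rewrite !in_internal_clusters_Node DB !orbT.
have leafP U : leaf_set U \subset leaf_set A :|: leaf_set T0 ->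
    (forall D, D \in internal_clusters U -> D \in internal_clusters (Node T0 V)) ->
    exists u, U = Leaf u.
  case: U => [u|U0 U1 sU inU]; first by exists u.
  case/negP: npAC; apply: polychrome_sub sU _; apply/polyT/inU/internal_cluster_root.
have [c eqC] := leafP _ (subsetUr _ _) in0.
have [a eqA] : exists a, A = Leaf a.
  apply: leafP (subsetUl _ _) _ => D DA; apply: in1; by rewrite !in_internal_clusters_Node DA !orbT.
have eq_ac : col a = col c.
  apply/eqP; apply: contraR npAC => neq_ac; apply/polychromeP; exists a, c.
  by rewrite eqA eqC !leaf_setE !in_setE !eqxx orbT.
have lt_ca : c < a.
  move: nbl dTA; rewrite eqA eqC /blocked eq_ac eqxx andbT !leaf_setE disjoints1 in_setE -leqNgt.
  by rewrite leq_eqVlt val_eqE => /orP[-> // | ].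
rewrite eqC leaf_setE disjoints1 in dTB; rewrite eqA leaf_setE disjoints1 in dAB.
have eqL : leaf_set (Node (Leaf a) (Node (Leaf c) B)) = leaf_set (Node T0 V).
  by rewrite eqC /V eqA !leaf_setE setUCA.
exists (Node (Leaf a) (Node (Leaf c) B)), (leaf_set V); split=> //.
- split=> //.
    rewrite !canonical_Node cB !leaf_setE !disjoints1 !in_setE dTB (negPf dAB) orbF.
    rewrite -val_eqE /= gtn_eqF //=; apply/andP; split.
      apply/exists_inP; exists m => //; apply/forall_inP=> y yL; apply: mmax.
      by rewrite eqC !leaf_setE !in_setE; move: yL; rewrite !in_setE => /orP[] ->; rewrite ?orbT.
    apply/exists_inP; exists m; first by rewrite !in_setE m'B orbT.
    apply/forall_inP=> y yL; apply: mmax.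
    by rewrite -leaf_set_Node -/V -eqL !leaf_setE.
  rewrite eqC /V eqA; constructor 1; rewrite !leaf_setE.
  exact: subset_lt_swap.
- apply/subsetP=> D; rewrite in_setD1 !in_internal_clusters_Node -/V eqL.
  by case/andP=> /negPf->; rewrite eqC eqA !in_set0 /= => /orP[] ->; rewrite ?orbT.
- move=> D; rewrite in_internal_clusters_Node eqL in_internal_clusters_Node !in_set0.
  case/or4P=> [/eqP -> | // | /eqP -> | ].
  + by left; apply: internal_cluster_root.
  + have polyV : polychrome (leaf_set V) by apply/polyT/in1/internal_cluster_root.
    have polyVC : polychrome (~: leaf_set V) by apply/copoly1/internal_cluster_root.
    right; split.
      rewrite !leaf_setE; apply: polychrome_swap eq_ac _ polyV.
      by rewrite /V eqA !leaf_setE.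
    have -> : ~: leaf_set (Node (Leaf c) B) = a |: ~: (a |: (c |: leaf_set B)).
      apply/setP=> y; rewrite !leaf_setE !in_setE; have [-> | //] := eqVneq y a.
      by rewrite -val_eqE /= gtn_eqF // (negPf dAB).
    apply: polychrome_swap (esym eq_ac) _ polyVC; rewrite /V eqA.
    apply/subsetP=> y; rewrite !leaf_setE !in_setE; case: (y == c) => //=.
  + by rewrite orFb => DB; left; apply: in1; rewrite !in_internal_clusters_Node DB !orbT.
Qed.

End Flips.

Section MaximalLaminarFamilies.

Variables (N : nat) (X : eqType) (col : 'I_N -> X) (r : 'I_N) (H : {set {set 'I_N}}).
Implicit Types (L M A B : {set 'I_N}).

Local Notation poly := (polychrome col).

Hypothesis H_lam : forall A B, A \in H -> B \in H -> laminar A B.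
Hypothesis H_root : forall A, A \in H -> r \notin A.
Hypothesis H_poly : forall A, A \in H -> poly A && poly (~: A).
Hypothesis H_max : forall A, r \notin A -> poly A -> poly (~: A) ->
  (forall B, B \in H -> laminar A B) -> A \in H.

Variables u1 u2 v : 'I_N.
Hypothesis u_neq : u1 != u2.
Hypothesis v_neq : v != r.
Hypothesis col_u1 : col u1 != col r.
Hypothesis col_u2 : col u2 != col r.
Hypothesis col_v : col v = col r.

Definition hull L := (L \in H) || (L == ~: [set r]).

Lemma hull_root L : hull L -> r \notin L.
Proof. by case/orP=> [/H_root // | /eqP ->]; rewrite !inE eqxx. Qed.

Lemma hull_laminar L B : hull L -> B \in H -> laminar L B.
Proof.
case/orP=> [LH BH | /eqP -> BH]; first exact: H_lam.
by rewrite /laminar subsetC sub1set inE (H_root BH) orbT.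
Qed.

Lemma disjoint_setD A B : [disjoint B & A :\: B].
Proof. by rewrite -setI_eq0; apply/eqP/setP=> x; rewrite !inE; case: (x \in B). Qed.

Lemma laminar_complement L M : hull L -> M \subset L ->
    poly (L :\: M) -> poly (~: (L :\: M)) ->
    (forall A, A \in H -> A \proper L -> A \subset M \/ [disjoint A & M]) ->
  L :\: M \in H.
Proof.
move=> hL sML pY pYC HM; apply: H_max => //.
  by rewrite inE (negPf (hull_root hL)) andbF.
move=> B BH; have := hull_laminar hL BH; rewrite /laminar => /or3P[sLB | sBL | dLB].
- by rewrite (subset_trans (subsetDl _ _)).
- have [eqBL | neqBL] := eqVneq B L; first by rewrite eqBL subsetDl.
  have [] := HM B BH; first by rewrite properEneq neqBL.
    by move=> sBM; rewrite disjoint_sym (disjointWl sBM) ?orbT // disjoint_setD.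
  by move=> dBM; rewrite subsetD sBL dBM orbT.
- by rewrite (disjointWl (subsetDl _ _)) ?orbT.
Qed.

Lemma hull_split L : hull L -> 1 < #|L| ->
  exists M, [/\ M \subset L, M != set0, L :\: M != set0,
    (M \in H) || (#|M| == 1) & (L :\: M \in H) || (#|L :\: M| == 1)].
Proof.
move=> hL L2.
have split1 y : y \in L -> poly (L :\ y) -> poly (y |: ~: L) ->
    (forall A, A \in H -> A \proper L -> y \notin A) ->
    exists M, [/\ M \subset L, M != set0, L :\: M != set0,
      (M \in H) || (#|M| == 1) & (L :\: M \in H) || (#|L :\: M| == 1)].
  move=> yL pY pYC Hy; exists [set y]; rewrite sub1set yL cards1 orbT; split=> //.
  - by apply/set0Pn; exists y; rewrite inE.
  - by rewrite -card_gt0 ltnW ?(polychrome_card pY).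
  - rewrite laminar_complement ?sub1set // => [|A AH pA].
      by rewrite setDE setCI setCK setUC.
    by right; rewrite disjoint_sym disjoints1 Hy.
have [/exists_inP[A0 A0H pA0] | noA] := boolP [exists A in H, A \proper L]; last first.
  have {}noA y A : A \in H -> A \proper L -> y \notin A.
    by move=> AH pA; case/negP: noA; apply/exists_inP; exists A.
  case/orP: (hL) => [LH | /eqP eqL]; last first.
    apply: (split1 u1) (noA u1) => //; rewrite eqL.
    - by rewrite !inE; apply: contraNneq col_u1 => ->.
    - apply/polychromeP; exists u2, v; rewrite !inE v_neq col_v eq_sym u_neq col_u2.
      have -> : v != u1 by apply: contraNneq col_u1 => <-; rewrite col_v.
      by have -> : u2 != r by apply: contraNneq col_u2 => ->.
    - by rewrite setCK; apply/polychromeP; exists u1, r; rewrite !inE !eqxx orbT.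
  have /andP[/polychromeP[x [y [xL yL xy]]] pLC] := H_poly LH.
  have neq_xy : x != y by apply: contraNneq xy => ->.
  have [|] := boolP (L \subset [set x; y]) => [sL | /subsetPn[w wL]].
    exists [set x]; rewrite sub1set xL cards1 orbT; split=> //.
    - by apply/set0Pn; exists x; rewrite inE.
    - by apply/set0Pn; exists y; rewrite !inE eq_sym neq_xy.
    - apply/orP; right; apply/cards1P; exists y; apply/eqP.
      rewrite eqEsubset sub1set in_setD1 eq_sym neq_xy yL !andbT.
      by apply/subsetP=> z /setD1P[zx /(subsetP sL)]; rewrite !inE (negPf zx).
  rewrite !inE negb_or => /andP[wx wy]; apply: (split1 w) (noA w) => //.
    by apply/polychromeP; exists x, y; rewrite !inE xL yL !(eq_sym _ w) wx wy.
  exact: polychrome_sub (subsetUr _ _) pLC.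
have [M /andP[MH pM] Mmax] :=
  @arg_maxnP _ A0 [pred A in H | A \proper L] (fun A => #|A|) (introT andP (conj A0H pA0)).
have HM A : A \in H -> A \proper L -> A \subset M \/ [disjoint A & M].
  move=> AH pA; have := H_lam AH MH; case/or3P; [by left | move=> sMA | by right].
  by left; have /eqP <- // : M == A; rewrite eqEcard sMA; apply: Mmax; rewrite inE AH pA.
have /andP[polyM polyMC] := H_poly MH; have sML := proper_sub pM.
have Yn0 : L :\: M != set0 by rewrite setD_eq0; case/andP: pM.
have [pY | npY] := boolP (poly (L :\: M)).
  exists M; rewrite MH sML Yn0; split=> //.
    by apply: contraTneq polyM => ->; apply/negP=> /polychrome_card; rewrite cards0.
  rewrite laminar_complement //; apply: polychrome_sub polyM.
  by rewrite subsetC subsetDr.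
case/set0Pn: (Yn0) => y /setDP[yL yM].
have mono z : z \in L -> z \notin M -> col z = col y.
  move=> zL zM; apply/eqP; apply: contraR npY => neq; apply/polychromeP; exists z, y.
  by rewrite !inE zL zM yL yM.
apply: (split1 y) => //.
- apply: polychrome_sub polyM; apply/subsetP=> z zM; rewrite !inE (subsetP sML) // andbT.
  by apply: contraNneq yM => <-.
- case/orP: (hL) => [LH | /eqP eqL].
    by apply: polychrome_sub (subsetUr _ _) _; case/andP: (H_poly LH).
  have neq_y : col y != col r.
    apply: contraL polyMC => /eqP eq_y; apply/negP=> /polychromeP[a [b []]].
    have colr z : z \notin M -> col z = col r.
      have [-> // | zr] := eqVneq z r; rewrite -eq_y; apply: mono.
      by rewrite eqL !inE.
    by rewrite !inE => /colr -> /colr ->; rewrite eqxx.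
  by rewrite eqL setCK; apply/polychromeP; exists y, r; rewrite !inE !eqxx orbT.
move=> A AH pA; apply/negP=> yA; have [/subsetP/(_ y yA) | dAM] := HM A AH pA.
  by rewrite (negPf yM).
case/negP: npY; have /andP[polyA _] := H_poly AH; apply: polychrome_sub polyA.
by rewrite subsetD (proper_sub pA).
Qed.

Lemma laminar_tree_exists L : hull L || (#|L| == 1) ->
  exists T : btree N, [/\ canonical T, leaf_set T = L
    & forall A, A \in internal_clusters T -> A \in H \/ A = L].
Proof.
have [k] := ubnP #|L|; elim: k L => // k IH L ltLk.
have [/cards1P[i ->] _ | L1] := boolP (#|L| == 1).
  by exists (Leaf i); rewrite leaf_setE; split=> // A; rewrite inE.
rewrite orbF => hL.
have L2 : 1 < #|L|.
  rewrite ltn_neqAle eq_sym L1 card_gt0; case/orP: hL => [/H_poly/andP[/polychrome_card pL _]|/eqP->].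
    by rewrite -card_gt0 ltnW.
  by apply/set0Pn; exists v; rewrite !inE.
have [M [sML M0 Y0 hM hY]] := hull_split hL L2.
have cardL : #|M| + #|L :\: M| = #|L| by rewrite -(cardsID M L) (setIidPr sML).
have hull1 A : (A \in H) || (#|A| == 1) -> hull A || (#|A| == 1).
  by rewrite /hull => /orP[] ->; rewrite ?orbT.
have [||T [cT eqT clT]] := IH M; [ | exact: hull1 |].
  by rewrite -ltnS (leq_trans _ ltLk) // ltnS -cardL -addn1 leq_add2l card_gt0.
have [||U [cU eqU clU]] := IH (L :\: M); [ | exact: hull1 |].
  by rewrite -ltnS (leq_trans _ ltLk) // ltnS -cardL -add1n leq_add2r card_gt0.
have [|J [cJ eqJ clJ]] := canonical_join cT cU.
  by rewrite eqT eqU disjoint_setD.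
have eqJL : leaf_set T :|: leaf_set U = L.
  by rewrite eqT eqU -{2}(setID L M) (setIidPr sML).
rewrite eqJL in eqJ clJ; exists J; split=> // A; rewrite clJ in_setU1 in_setU.
have leaf_or (V : btree N) B : canonical V -> leaf_set V = B -> (B \in H) || (#|B| == 1) ->
    A \in internal_clusters V -> A \in H \/ A = B -> A \in H.
  move=> cV eqV /orP[BH _ [//|-> //] | /eqP B1 AV _].
  by have := card_internal_clusters cV; rewrite eqV B1 => -[/eqP]; rewrite cards_eq0 => /eqP V0; rewrite V0 inE in AV.
case/or3P=> [/eqP -> | AT | AU]; [by right | left | left].
  exact: leaf_or cT eqT hM AT (clT A AT).
exact: leaf_or cU eqU hY AU (clU A AU).
Qed.

Lemma maximal_laminar_tree :
  exists T : btree N, [/\ canonical T, leaf_set T = ~: [set r]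
    & internal_clusters T :\ leaf_set T = H].
Proof.
have [|T [cT eqT clT]] := @laminar_tree_exists (~: [set r]); first by rewrite /hull eqxx orbT.
exists T; split=> //; apply/eqP; rewrite eqEsubset eqT; apply/andP; split; apply/subsetP=> A.
  by case/setD1P=> neqA /clT[//|eqA]; rewrite eqA eqxx in neqA.
move=> AH; rewrite in_setD1; apply/andP; split.
  apply: contraTneq AH => ->; apply/negP=> /H_poly/andP[_].
  by rewrite setCK => /polychrome_card; rewrite cards1.
have /andP[pA _] := H_poly AH; apply: internal_clusters_maximal => [||B].
- exact: polychrome_card pA.
- by rewrite eqT subsetC sub1set inE H_root.
- case/clT=> [BH | ->]; first exact: H_lam.
  by rewrite /laminar subsetC sub1set inE H_root.
Qed.

End MaximalLaminarFamilies.

Section TreeSplits.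

Variables (N : nat) (r : 'I_N).
Hypothesis r0 : r = 0 :> nat.
Implicit Types (A B : {set 'I_N}) (T : btree N).

Lemma trivalent_treeE T : trivalent_tree T = canonical T && (leaf_set T == ~: [set r]).
Proof.
rewrite /trivalent_tree /canonical -andbA [max_in_second T && _]andbC.
suff -> : [set i : 'I_N | i != 0 :> nat] = ~: [set r] by [].
by apply/setP=> i; rewrite !inE -val_eqE /= r0.
Qed.

Lemma split_inj A B : r \notin A -> r \notin B -> [set A; ~: A] = [set B; ~: B] -> A = B.
Proof.
move=> rA rB eqAB; have : A \in [set B; ~: B] by rewrite -eqAB !inE eqxx.
by rewrite !inE => /orP[/eqP // | /eqP eqA]; move: rA; rewrite eqA inE rB.
Qed.

Lemma compatible_laminar A B : r \notin A -> r \notin B ->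
  compatible [set A; ~: A] [set B; ~: B] = laminar A B.
Proof.
move=> rA rB; apply/exists_inP/idP => [[A' + /exists_inP[B' + dAB]] | ].
  rewrite !inE => /orP[] /eqP eA /orP[] /eqP eB; move: dAB; rewrite eA eB /laminar.
  - by rewrite setI_eq0 => ->; rewrite !orbT.
  - by rewrite setI_eq0 disjoints_subset setCK => ->.
  - by rewrite setIC setI_eq0 disjoints_subset setCK => ->; rewrite orbT.
  - by move/eqP/setP/(_ r); rewrite !inE rA rB.
case/or3P=> [sAB | sBA | dAB].
- exists A; rewrite ?inE ?eqxx //; apply/exists_inP; exists (~: B); rewrite ?inE ?eqxx ?orbT //.
  by rewrite setI_eq0 disjoints_subset setCK.
- exists (~: A); rewrite ?inE ?eqxx ?orbT //; apply/exists_inP; exists B; rewrite ?inE ?eqxx //.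
  by rewrite setIC setI_eq0 disjoints_subset setCK.
- exists A; rewrite ?inE ?eqxx //; apply/exists_inP; exists B; rewrite ?inE ?eqxx //.
  by rewrite setI_eq0.
Qed.

Lemma tree_splitsE T : canonical T ->
  tree_splits T = [set [set A; ~: A] | A in internal_clusters T :\ leaf_set T].
Proof.
case: T => [i _|T0 T1 cT]; first by rewrite /= set0D imset0.
by rewrite proper_internal_clusters.
Qed.

Lemma trivalent_root_notin T A : trivalent_tree T -> A \in internal_clusters T -> r \notin A.
Proof.
rewrite trivalent_treeE => /andP[_ /eqP eqT] /internal_cluster_sub /subsetP sA.
by apply/negP=> /sA; rewrite eqT !inE eqxx.
Qed.

Lemma mem_tree_splits T A : trivalent_tree T -> r \notin A ->
  ([set A; ~: A] \in tree_splits T) = (A \in internal_clusters T :\ leaf_set T).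
Proof.
move=> tT rA; have := tT; rewrite trivalent_treeE => /andP[cT _]; rewrite tree_splitsE //.
apply/imsetP/idP => [[B BT /split_inj -> //] | AT]; last by exists A.
by case/setD1P: BT => _ /(trivalent_root_notin tT).
Qed.

Lemma tree_splits_clusters T T' : trivalent_tree T -> trivalent_tree T' ->
  tree_splits T = tree_splits T' -> internal_clusters T \subset internal_clusters T'.
Proof.
move=> tT tT' eqS; apply/subsetP=> A AT; have rA := trivalent_root_notin tT AT.
have [eqA | neqA] := eqVneq A (leaf_set T); last first.
  have : A \in internal_clusters T' :\ leaf_set T'.
    by rewrite -mem_tree_splits // -eqS mem_tree_splits // in_setD1 neqA.
  by case/setD1P.
move: tT tT'; rewrite !trivalent_treeE => /andP[cT /eqP eqL] /andP[cT' /eqP eqL'].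
rewrite eqA eqL -eqL'; case: T' cT' eqL' {eqS} => [i _ eqL' | U V _ _]; last exact: internal_cluster_root.
have := card_internal_clusters cT; rewrite eqL -eqL' leaf_setE cards1 => -[/eqP].
by rewrite cards_eq0 => /eqP T0; rewrite T0 inE in AT.
Qed.

Lemma tree_splits_inj T T' : trivalent_tree T -> trivalent_tree T' ->
  tree_splits T = tree_splits T' -> T = T'.
Proof.
move=> tT tT' eqS.
have le (U U' : btree N) : trivalent_tree U -> trivalent_tree U' -> tree_splits U = tree_splits U' ->
    U = U' \/ tree_lt U U'.
  move=> tU tU' eqU.
  have rU := rigid_clusters id (tree_splits_clusters tU tU' eqU).
  move: tU tU'; rewrite !trivalent_treeE => /andP[cU /eqP eqL] /andP[cU' /eqP eqL'].
  apply: rigid_le rU => //; first by rewrite eqL.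
  elim: {eqU eqL eqL'} U' cU' => [i|U0 IH0 U1 IH1] cU' A; first by rewrite inE.
  move: (cU'); rewrite in_internal_clusters_Node canonical_Node => /and4P[c0 c1 dU _].
  case/or3P=> [/eqP -> | /(IH0 c0) // | /(IH1 c1) //].
  have [[x xU0] [y yU1]] := (set0Pn _ (leaf_set_neq0 U0), set0Pn _ (leaf_set_neq0 U1)).
  apply/polychromeP; exists x, y; rewrite leaf_setE !in_setU xU0 yU1 orbT; split=> //.
  by apply: contraTneq yU1 => <-; apply: disjoint_mem dU xU0.
have [// | lt1] := le _ _ tT tT' eqS; have [// | lt2] := le _ _ tT' tT (esym eqS).
by case: (tree_lt_irr (tree_lt_trans lt1 lt2)).
Qed.

End TreeSplits.

Section Bicolored.

Variables d n : nat.
Local Notation N := (n + d).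
Local Notation poly := (polychrome (@marked d n)).
Implicit Types (A B : {set 'I_N}) (S : {set {set 'I_N}}) (F : {set {set {set 'I_N}}}).

Lemma polychrome_marked A :
  poly A = [exists i in A, marked i] && [exists i in A, ~~ marked i].
Proof.
apply/polychromeP/andP => [[x [y [xA yA]]] | [/exists_inP[x xA mx] /exists_inP[y yA my]]].
  case mx: (marked x); case my: (marked y) => // _; split; apply/exists_inP;
    by [exists x; rewrite ?mx | exists y; rewrite ?my].
by exists x, y; rewrite mx (negPf my).
Qed.

Lemma bicolored_split A : bicolored [set A; ~: A] = poly A && poly (~: A).
Proof.
have blockE B : [&& 1 < #|B|, [exists i in B, marked i] & [exists i in B, ~~ marked i]] = poly B.
  rewrite polychrome_marked; apply/andb_idl; rewrite -polychrome_marked.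
  exact: polychrome_card.
apply/andP/andP => [[_ /forall_inP h] | [pA pAC]].
  by rewrite -!blockE !h // !inE eqxx ?orbT.
split; last by apply/forall_inP=> B /set2P[] ->; rewrite blockE.
have [/polychrome_card cA /polychrome_card cAC] := (pA, pAC).
have A0 : A != set0 by rewrite -card_gt0 ltnW.
have AC0 : ~: A != set0 by rewrite -card_gt0 ltnW.
have neqA : A != ~: A.
  case/set0Pn: A0 => x xA; apply/eqP=> /setP/(_ x); by rewrite inE xA.
rewrite /is_split cards2 neqA eqxx andbT; apply/and3P; split.
- by rewrite /cover big_setU1 ?inE //= big_set1 setUCr.
- apply/trivIsetP=> B C /set2P[] -> /set2P[] ->; rewrite ?eqxx //= => _.
    by rewrite -setI_eq0 setICr.
  by rewrite -setI_eq0 setIC setICr.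
- by rewrite !inE negb_or !(eq_sym set0) A0 AC0.
Qed.

Lemma bicoloredP (r : 'I_N) S : bicolored S ->
  exists A, [/\ r \notin A, S = [set A; ~: A], poly A & poly (~: A)].
Proof.
move=> bS; have [A eqS] : exists A, S = [set A; ~: A].
  case/andP: bS => /andP[/and3P[/eqP covS tS _] /cards2P[A [B [neqAB eqS]]]] _.
  exists A; rewrite eqS; congr [set _; _]; apply/setP=> x; rewrite inE.
  have dAB : [disjoint A & B] by apply: (trivIsetP tS); rewrite ?eqS ?inE ?eqxx ?orbT.
  have: x \in cover S by rewrite covS inE.
  rewrite /cover eqS big_setU1 /=; last by rewrite inE.
  rewrite big_set1 inE.
  by case: (boolP (x \in A)) => [xA _ | _ /= ->] //; rewrite (disjointFr dAB).
move: bS; rewrite eqS bicolored_split => /andP[pA pAC].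
have [rA | rA] := boolP (r \in A); last by exists A.
by exists (~: A); rewrite setCK inE rA setUC.
Qed.

Lemma bicolored_gt1 S : bicolored S -> (1 < n) && (1 < d).
Proof.
move=> bS; have [r] : exists r : 'I_N, r \in [set: 'I_N].
  apply/set0Pn; case/andP: bS => /andP[/and3P[/eqP <- _ S0] /eqP S2] _.
  have /card_gt0P[A AS] : 0 < #|S| by rewrite S2.
  have An0 : A != set0 by apply: contraNneq S0 => <-.
  case/set0Pn: An0 => x xA; apply/set0Pn; exists x; apply/bigcupP; by exists A.
move=> _; have [A [_ _ pA pAC]] := bicoloredP r bS.
move: pA pAC; rewrite !polychrome_marked.
move=> /andP[/exists_inP[x xA mx] /exists_inP[y yA my]].
move=> /andP[/exists_inP[x' +  mx'] /exists_inP[y' + my']]; rewrite !inE => x'A y'A.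
have neqx : x != x' by apply: contraNneq x'A => <-.
have neqy : y != y' by apply: contraNneq y'A => <-.
rewrite /marked -!leqNgt in mx mx' my my'; rewrite -val_eqE /= in neqx neqy.
have [lty lty'] := (ltn_ord y, ltn_ord y').
apply/andP; split.
  move: neqx; rewrite neq_ltn => /orP[lt_xx | lt_xx].
    exact: leq_ltn_trans (leq_ltn_trans _ lt_xx) mx'.
  exact: leq_ltn_trans (leq_ltn_trans _ lt_xx) mx.
rewrite -(ltn_add2l n) addn1; move: neqy; rewrite neq_ltn => /orP[lt_yy | lt_yy].
  by rewrite (leq_ltn_trans _ lty') // (leq_ltn_trans my).
by rewrite (leq_ltn_trans _ lty) // (leq_ltn_trans my').
Qed.

Lemma faces_splits (r : 'I_N) (G : {set {set 'I_N}}) :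
    (forall A, A \in G -> [/\ r \notin A, poly A & poly (~: A)]) ->
    (forall A B, A \in G -> B \in G -> laminar A B) ->
  [set [set A; ~: A] | A in G] \in Tprime d n.
Proof.
move=> polyG lamG; rewrite inE; apply/andP; split; apply/forall_inP=> S /imsetP[A AG ->].
  by have [_ pA pAC] := polyG A AG; rewrite bicolored_split pA.
apply/forall_inP=> S' /imsetP[B BG ->].
by rewrite (@compatible_laminar _ r) ?lamG //; [case: (polyG A AG) | case: (polyG B BG)].
Qed.

Lemma faces_compatible F S S' :
  F \in Tprime d n -> S \in F -> S' \in F -> compatible S S'.
Proof. by rewrite inE => /andP[_ /forall_inP cF] /cF/forall_inP; apply. Qed.

Lemma faces_bicolored F S : F \in Tprime d n -> S \in F -> bicolored S.
Proof. by rewrite inE => /andP[/forall_inP bF _] /bF. Qed.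

Lemma facets_degenerate F : ~~ ((1 < n) && (1 < d)) -> F \in facets (Tprime d n) -> F = set0.
Proof.
move=> small; rewrite inE => /maxsetp fF; apply/eqP; apply: contraR small => /set0Pn[S SF].
exact: bicolored_gt1 (faces_bicolored fF SF).
Qed.

Definition bicolored_tree T :=
  trivalent_tree T /\
  forall A, A \in internal_clusters T :\ leaf_set T -> poly A && poly (~: A).

Lemma bicolored_tree_facet (r : 'I_N) T : r = 0 :> nat ->
  bicolored_tree T -> tree_splits T \in facets (Tprime d n).
Proof.
move=> r0 [tT polyT]; have := tT; rewrite (trivalent_treeE r0) => /andP[cT /eqP eqT].
rewrite inE; apply/maxsetP; split.
  rewrite tree_splitsE //; apply: (@faces_splits r) => [A AT | A B /setD1P[_ AT] /setD1P[_ BT]].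
    have /andP[pA pAC] := polyT A AT; case/setD1P: AT => _ AT.
    by split=> //; apply: trivalent_root_notin r0 _ _ tT AT.
  exact: internal_clusters_laminar BT.
move=> F fF sTF; apply/eqP; rewrite eqEsubset sTF andbT; apply/subsetP=> S SF.
have [A [rA eqS pA pAC]] := bicoloredP r (faces_bicolored fF SF).
rewrite eqS (mem_tree_splits r0) // in_setD1; apply/andP; split.
  by apply: contraTneq pAC => ->; rewrite eqT setCK; apply/negP=> /polychrome_card; rewrite cards1.
apply: internal_clusters_maximal; first exact: polychrome_card pA.
  by rewrite eqT subsetC sub1set inE.
move=> B BT; have [-> | neqB] := eqVneq B (leaf_set T).
  by rewrite /laminar eqT subsetC sub1set inE rA.
have rB := trivalent_root_notin r0 tT BT.
rewrite -(@compatible_laminar _ r) // -eqS; apply: faces_compatible fF SF _.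
by apply: (subsetP sTF); rewrite (mem_tree_splits r0) // in_setD1 neqB.
Qed.

Lemma facet_bicolored_tree (r : 'I_N) F : r = 0 :> nat -> 1 < n -> 1 < d ->
  F \in facets (Tprime d n) -> exists2 T, bicolored_tree T & tree_splits T = F.
Proof.
move=> r0 n2 d2; rewrite inE => /maxsetP[fF maxF].
pose H := [set A : {set 'I_N} | (r \notin A) && ([set A; ~: A] \in F)].
have HP A : A \in H -> [/\ r \notin A, [set A; ~: A] \in F, poly A & poly (~: A)].
  rewrite inE => /andP[rA AF]; have := faces_bicolored fF AF.
  by rewrite bicolored_split => /andP[].
have FH : F = [set [set A; ~: A] | A in H].
  apply/setP=> S; apply/idP/imsetP => [SF | [A /HP[_ AF _ _] -> //]].
  have [A [rA eqS _ _]] := bicoloredP r (faces_bicolored fF SF).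
  by exists A; rewrite // inE rA -eqS.
have lamH A B : A \in H -> B \in H -> laminar A B.
  move=> /HP[rA AF _ _] /HP[rB BF _ _]; rewrite -(@compatible_laminar _ r) //.
  exact: faces_compatible fF _ _.
have u1_lt : n < N by rewrite -addn1 leq_add2l ltnW.
have u2_lt : n.+1 < N by rewrite -addn2 leq_add2l.
have v_lt : 1 < N by rewrite (leq_trans n2) ?leq_addr.
have mr : marked r by rewrite /marked r0 ltnW.
have [||||||||T [cT eqT clT]] := @maximal_laminar_tree _ _ (@marked d n) r H lamH _ _ _
  (Ordinal u1_lt) (Ordinal u2_lt) (Ordinal v_lt).
- by move=> A /HP[].
- by move=> A /HP[_ _ -> ->].
- move=> A rA pA pAC lamA; rewrite inE rA.
  suff <- : [set [set B; ~: B] | B in A |: H] = F by apply/imsetP; exists A; rewrite ?setU11.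
  apply: maxF; last by rewrite {1}FH; apply/imsetS/subsetUr.
  apply: (@faces_splits r) => [B | B C]; first by case/setU1P=> [-> // | /HP[]].
  case/setU1P=> [-> | BH] /setU1P[-> | CH]; [by rewrite /laminar subxx | exact: lamA | | exact: lamH].
  by rewrite laminarC lamA.
- by rewrite -val_eqE /= ltn_eqF.
- by rewrite -val_eqE /= r0.
- by rewrite mr /marked /= ltnn.
- by rewrite mr /marked /= ltnNge leqnSn.
- by rewrite mr /marked /= n2.
exists T; last by rewrite tree_splitsE // clT.
split; first by rewrite (trivalent_treeE r0) cT eqT eqxx.
by move=> A; rewrite clT => /HP[_ _ -> ->].
Qed.

End Bicolored.

Lemma label_zero_exists N (T : btree N) : exists r : 'I_N, r = 0 :> nat.
Proof.
case/set0Pn: (leaf_set_neq0 T) => i _.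
by exists (Ordinal (leq_ltn_trans (leq0n i) (ltn_ord i))).
Qed.

Lemma tree_order_irr N (F : {set {set {set 'I_N}}}) : ~ tree_order F F.
Proof.
case=> T' [T [tT' tT eqT' eqT]]; have [r r0] := label_zero_exists T.
by rewrite (tree_splits_inj r0 tT' tT) ?eqT // => /tree_lt_irr.
Qed.

Lemma tree_order_trans N (F G K : {set {set {set 'I_N}}}) :
  tree_order F G -> tree_order G K -> tree_order F K.
Proof.
case=> T1 [T2 [t1 t2 s1 s2 lt12]] [T3 [T4 [t3 t4 s3 s4 lt34]]].
have [r r0] := label_zero_exists T1.
exists T1, T4; split=> //; apply: tree_lt_trans lt12 _.
by rewrite (tree_splits_inj r0 t2 t3) ?s2.
Qed.

Lemma tree_order_shelling (d n : nat) : shelling_order (Tprime d n) (@tree_order (n + d)).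
Proof.
have [/andP[n2 d2] | small] := boolP ((1 < n) && (1 < d)); last first.
  have deg F : F \in facets (Tprime d n) -> F = set0 by exact: facets_degenerate.
  split; first by move=> F G /deg -> /deg ->.
    split=> [F _ | F G K _ _ _ | F G /deg -> /deg ->] //; first exact: tree_order_irr.
    exact: tree_order_trans.
  by move=> F G /deg -> /deg -> /tree_order_irr.
have r_lt : 0 < n + d by rewrite addn_gt0 ltnW.
pose r := Ordinal r_lt; have r0 : r = 0 :> nat by [].
have treeP F := @facet_bicolored_tree d n r F r0 n2 d2.
have treeE T : trivalent_tree T -> canonical T /\ leaf_set T = ~: [set r].
  by rewrite (trivalent_treeE r0) => /andP[cT /eqP].
split.
- have cardF F : F \in facets (Tprime d n) -> #|F| = #|~: [set r]|.-2.
    move=> /treeP[T [tT polyT] <-]; have [cT eqT] := treeE T tT.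
    rewrite tree_splitsE // card_in_imset => [|A B /setD1P[_ AT] /setD1P[_ BT]].
      have: leaf_set T \in internal_clusters T.
        case: T cT eqT {tT polyT} => [i _ eqT | U V _ _]; last exact: internal_cluster_root.
        have: 1 < #|~: [set r]| by rewrite cardsC1 card_ord -subn1 ltn_subRL (leq_add n2 (ltnW d2)).
        by rewrite -eqT leaf_setE cards1.
      move=> LT; have := card_internal_clusters cT.
      by rewrite (cardsD1 (leaf_set T)) LT eqT => <-.
    by apply: (@split_inj _ r); apply: trivalent_root_notin r0 _ _ tT _.
  by move=> F G /cardF -> /cardF ->.
- split=> [F _ | F G K _ _ _ | F G /treeP[T [tT _] <-] /treeP[U [tU _] <-] neq].
  + exact: tree_order_irr.
  + exact: tree_order_trans.
  + have [[cT eqT] [cU eqU]] := (treeE T tT, treeE U tU).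
    have [|neqTU|lt|lt] := tree_lt_total cT cU; first by rewrite eqT.
    * by apply: neq; rewrite neqTU.
    * by left; exists T, U.
    * by right; exists U, T.
move=> C' C /treeP[T' [tT' polyT'] eqC'] /treeP[T [tT polyT] eqC] [U' [U [tU' tU eqU' eqU]]].
rewrite (tree_splits_inj r0 tU' tT') ?eqU' // (tree_splits_inj r0 tU tT) ?eqU // => ltT.
have [[cT eqT] [cT' eqT']] := (treeE T tT, treeE T' tT').
have u_lt : n < n + d by rewrite -addn1 leq_add2l ltnW.
have v_lt : 1 < n + d by rewrite (leq_trans n2) ?leq_addr.
have polyL : polychrome (@marked d n) (~: [set r]).
  apply/polychromeP; exists (Ordinal u_lt), (Ordinal v_lt).
  by rewrite !inE -!val_eqE /= /marked /= ltnn n2 -lt0n ltnW.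
have polyV V : bicolored_tree V ->
    forall A, A \in internal_clusters V -> polychrome (@marked d n) A.
  case=> tV pV A AV; have [_ eqV] := treeE V tV.
  have [-> | neqA] := eqVneq A (leaf_set V); first by rewrite eqV.
  by have /andP[] : polychrome (@marked d n) A && polychrome (@marked d n) (~: A)
    by apply: pV; rewrite in_setD1 neqA.
have nrT : ~~ rigid (@marked d n) (internal_clusters T') T.
  apply/negP=> /rigid_le-/(_ T' cT cT') []; rewrite ?eqT //.
  - exact: polyV.
  - by move=> eqTT'; apply: (@tree_lt_irr _ T); rewrite {1}eqTT'.
  - by move=> /tree_lt_trans/(_ ltT); apply: tree_lt_irr.
have [|||T'' [S [[cT'' eqT'' lt''] [ST SL ST'] sub'' new'']]] := flip cT _ _ _ nrT.
- exact: polyV.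
- by move=> A AT neqA; have /andP[] := polyT A (introT setD1P (conj neqA AT)).
- move=> m mT mmax; exists r; first by rewrite eqT !inE eqxx.
  have -> : marked r by rewrite /marked ltnW.
  have: n <= m by apply: (mmax (Ordinal u_lt)); rewrite eqT !inE -val_eqE /= -lt0n ltnW.
  by rewrite /marked leqNgt; case: (m < n).
have tT'' : trivalent_tree T'' by rewrite (trivalent_treeE r0) cT'' eqT'' eqT eqxx.
have rS := trivalent_root_notin r0 tT ST.
exists (tree_splits T''), [set S; ~: S]; split.
- apply: (bicolored_tree_facet r0); split=> // A /setD1P[neqA /new''[AT | [-> ->]]] //.
  by apply: polyT; rewrite in_setD1 AT -eqT'' neqA.
- by exists T'', T.
- by rewrite -eqC (mem_tree_splits r0) // in_setD1 SL ST.
- by rewrite -eqC' (mem_tree_splits r0) // in_setD1 (negPf ST') andbF.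
apply/subsetP=> R; rewrite -eqC tree_splitsE // => /setD1P[neqR /imsetP[A /setD1P[AL AT] eqR]].
have rA := trivalent_root_notin r0 tT AT; rewrite eqR (mem_tree_splits r0) //.
rewrite in_setD1 eqT'' AL (subsetP sub'') // in_setD1 AT andbT.
by apply: contraNneq neqR => eqA; rewrite eqR eqA.
Qed.

Theorem theorem3p2 (d n : nat) :
  shellable (Tprime d n) /\ shelling_order (Tprime d n) (@tree_order (n + d)).
Proof. by split; [exists (@tree_order (n + d)) |]; apply: tree_order_shelling. Qed.
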